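(* Let $T:[0,1]\to[0,1]$ be an interval exchange transformation with property $\tilde P$, and let $\mu$ be Lebesgue measure. Then there is a constant $K>0$ such that for every decreasing sequence $(r_n)$ of positive numbers with $r_n\ge K/n$ for all sufficiently large $n$, for Lebesgue-almost every $y\in[0,1]$ the sequence of balls $\{B(y,r_n)\}$ has the Borel–Cantelli property, i.e. $\sum_n\mu(B(y,r_n))=\infty$ and $\mu(\limsup_nT^{-n}B(y,r_n))=1$.
   Context: An interval exchange transformation is a bijective map of the interval obtained by cutting it into finitely many subintervals and rearranging them by translations (a bijective piecewise isometry); it preserves Lebesgue measure. For $n\ge1$ let $\delta(n)$ be the minimum distance between the discontinuity points of $T^n$. $T$ has property $\tilde P$ if it is ergodic with respect to Lebesgue measure and there exist a constant $C>0$ and an increasing sequence $n_k\to\infty$ with $\delta(n_k)\ge C/n_k$. $B(y,r)$ is the ball of radius $r$ centered at $y$; $\limsup_nS_n$ is the set of points lying in infinitely many $S_n$. *)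

(* Defs.v *)
From HB Require Import structures.
From mathcomp Require Import all_boot all_order all_algebra.
From mathcomp Require Import all_classical all_reals all_analysis.
Set Implicit Arguments. Unset Strict Implicit. Unset Printing Implicit Defensive.
Import Order.TTheory GRing.Theory Num.Theory.
Import numFieldNormedType.Exports.
Local Open Scope classical_set_scope.
Local Open Scope ring_scope.

Definition I01 {R : realType} : set R := [set x | 0 <= x < 1].

Definition is_IET {R : realType} (T : R -> R) : Prop :=
  exists (k : nat) (a t : nat -> R),
    [/\ a 0%N = 0, a k = 1,
        (forall i, (i < k)%N -> a i < a i.+1),
        (forall i x, (i < k)%N -> a i <= x < a i.+1 -> T x = x + t i)
      & set_bij I01 I01 T].

Definition ergodic_leb {R : realType} (T : R -> R) : Prop :=
  forall A : set R, measurable A -> A `<=` I01 ->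
    T @^-1` A `&` I01 = A ->
    (lebesgue_measure A = 0%E \/ lebesgue_measure A = 1%E).

Definition discont_pts {R : realType} (T : R -> R) (n : nat) : set R :=
  [set x | 0 < x < 1 /\ ~ {for x, continuous (iter n T)}].

(* delta(n) >= c, where delta(n) is the minimum distance between distinct
   discontinuity points of T^n (minimum over an empty family = +oo). *)
Definition delta_ge {R : realType} (T : R -> R) (n : nat) (c : R) : Prop :=
  forall x y, discont_pts T n x -> discont_pts T n y -> x != y ->
    c <= `|x - y|.

Definition property_Ptilde {R : realType} (T : R -> R) : Prop :=
  ergodic_leb T /\
  exists (C : R) (nk : nat -> nat), 0 < C /\
    (forall k, (nk k < nk k.+1)%N) /\
    (forall k, delta_ge T (nk k) (C / (nk k)%:R)).

Definition limsup_preim {R : realType} (T : R -> R) (y : R) (r : nat -> R)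
  : set R :=
  [set x | I01 x /\ forall N, exists2 n, (N <= n)%N & ball y (r n) (iter n T x)].

Definition I01c {R : realType} : set R := [set x | 0 <= x <= 1].

Definition BC_property {R : realType} (T : R -> R) (r : nat -> R) (y : R)
  : Prop :=
  (\sum_(0 <= n <oo) lebesgue_measure (ball y (r n) `&` I01c) = +oo)%E /\
  measurable (limsup_preim T y r) /\
  lebesgue_measure (limsup_preim T y r) = 1%E.

(* Main.v *)
Require Import Defs.
From HB Require Import structures.
From mathcomp Require Import all_boot all_order all_algebra.
From mathcomp Require Import all_classical all_reals all_analysis.
From mathcomp Require Import measurable_realfun.
From mathcomp Require Import zify ring lra.
Import Order.TTheory GRing.Theory Num.Theory.
Import numFieldNormedType.Exports.
Local Open Scope classical_set_scope.
Local Open Scope ring_scope.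

Set Implicit Arguments.
Unset Strict Implicit.
Unset Printing Implicit Defensive.

(* The first return map to [0, v) exchanges at most k + 1 intervals, so [0, 1)
   is, up to a null set, covered by at most k + 1 towers of disjoint intervals
   b, T b, ..., T^(h-1) b on which T acts by translation. One of them satisfies
   h * w >= 1 / (k + 1), where w <= v is its width. If x and y lie in levels
   i < l of this tower, then T^(l-i) x lies in the level of y, hence
   |T^(l-i) x - y| < w <= 1 / h <= 1 / (l - i). Letting v tend to 0 gives a set
   Y of positive measure such that for y in Y a set of positive measure of x
   comes within 1 / n of y at infinitely many times n. Ergodicity upgrades this
   to almost every x, and then, since T is locally an isometry, to almost every
   y, with K = 2. The divergence of the series follows from the Borel-Cantelli
   lemma. *)

(** * Measure of limsup sets and of translates *)

Lemma le_measure_limsup d (X : measurableType d) (R : realType)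
    (mu : {measure set X -> \bar R}) (A : (set X)^nat) (c : \bar R) :
  (forall n, measurable (A n)) -> (mu (\bigcup_(n >= 0) A n) < +oo)%E ->
  (forall N, exists2 n, (N <= n)%N & (c <= mu (A n))%E) ->
  (c <= mu (lim_sup_set A))%E.
Proof.
move=> mA Afin freq.
have cvgA := lim_sup_set_cvg mu A mA Afin.
have <- := cvg_lim (@ereal_hausdorff R) cvgA.
(* The measure of the limsup set is the limit of those of the tail unions, each containing some
   [A n] of measure at least [c]. *)
apply: lime_ge; first by apply/cvg_ex; eexists; exact: cvgA.
apply: nearW => N; have [n Nn cA] := freq N.
apply: (le_trans cA); apply: le_measure; rewrite ?inE//.
  exact: bigcup_measurable.
by move=> x Ax; exists n.
Qed.

(** The pushforward of Lebesgue measure under the translation agrees with it on half-open intervals,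
    so uniqueness applies. *)
Lemma lebesgue_measure_preimage_addr (R : realType) (t : R) (A : set R) :
  measurable A -> lebesgue_measure [set x | A (x + t)] = lebesgue_measure A.
Proof.
move=> mA.
pose f (x : measurableTypeR R) : measurableTypeR R := x + t.
have mf : measurable_fun setT f.
  by apply: continuous_measurable_fun => x; apply: cvgD => //; exact: cvg_cst.
rewrite [RHS](@lebesgue_measure_unique R
  (measure_function_pushforward__canonical__measure_function_Measure
    lebesgue_measure mf))//.
move=> _ [[x y] _ <-] /=; rewrite /pushforward /=.
have -> : f @^-1` `]x, y] = `]x - t, y - t]%classic.
  by apply/seteqP; split => z /=; rewrite !in_itv/= lerBrDr ltrBlDr.
rewrite !lebesgue_measure_itv/= !lte_fin ltrD2r; case: ifP => // _.
by rewrite -!EFinB; congr (_%:E); lra.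
Qed.

(** * Recurrence for ergodic measure-preserving maps of [[0, 1)] *)

Section unit_interval.
Variable R : realType.
Implicit Types (A : set R) (n : nat) (x y : R).
Local Notation mu := (@lebesgue_measure R).

Lemma I01E : @I01 R = `[0, 1[%classic.
Proof. by apply/seteqP; split => x /=; rewrite in_itv. Qed.

Lemma measurable_I01 : measurable (@I01 R).
Proof. by rewrite I01E. Qed.

Lemma I01cE : @I01c R = `[0, 1]%classic.
Proof. by apply/seteqP; split => x /=; rewrite in_itv. Qed.

Lemma measurable_I01c : measurable (@I01c R).
Proof. by rewrite I01cE. Qed.

Lemma lebesgue_measure_I01 : mu I01 = 1%E.
Proof. by rewrite I01E lebesgue_measure_itv/= lte01 oppr0 adde0. Qed.

Lemma lebesgue_measure_le1 A : measurable A -> A `<=` I01 -> (mu A <= 1)%E.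
Proof.
move=> mA AI; rewrite -lebesgue_measure_I01; apply: le_measure; rewrite ?inE//.
exact: measurable_I01.
Qed.

Lemma le_lebesgue_measure_limsup (A : (set R)^nat) (c : \bar R) :
  (forall n, measurable (A n)) -> (forall n, A n `<=` I01) ->
  (forall N, exists2 n, (N <= n)%N & (c <= mu (A n))%E) ->
  (c <= mu (lim_sup_set A))%E.
Proof.
move=> mA AI; apply: le_measure_limsup => //.
apply: (@le_lt_trans _ _ 1%E); last exact: ltry.
apply: lebesgue_measure_le1; first exact: bigcup_measurable.
by move=> x [n _ Ax]; exact: AI Ax.
Qed.

Variable T : R -> R.
Hypothesis TI : forall x, I01 x -> I01 (T x).
Hypothesis mT : forall A, measurable A -> measurable (T @^-1` A `&` I01).
Hypothesis muT : forall A, measurable A -> A `<=` I01 ->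
  mu (T @^-1` A `&` I01) = mu A.
Hypothesis ergT : ergodic_leb T.

Lemma iter_I01 n x : I01 x -> I01 (iter n T x).
Proof. by move=> Ix; elim: n => //= n; exact: TI. Qed.

(** [T] is total on [R] but controlled only on [[0, 1)], so all preimages are cut down to [I01];
    [TI] lets these truncations compose. *)
Lemma preimage_iterS n A : iter n.+1 T @^-1` A `&` I01 =
  T @^-1` (iter n T @^-1` A `&` I01) `&` I01.
Proof.
apply/seteqP; split => x /=; rewrite -iterS iterSr; last by case=> [] [].
by case=> Ax Ix; split=> //; split=> //; exact: TI.
Qed.

Lemma measurable_preimage_iter n A :
  measurable A -> measurable (iter n T @^-1` A `&` I01).
Proof.
move=> mA; elim: n => [|n IHn]; last by rewrite preimage_iterS; exact: mT.
by apply: measurableI => //; exact: measurable_I01.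
Qed.

Lemma lebesgue_measure_preimage_iter n A : measurable A -> A `<=` I01 ->
  mu (iter n T @^-1` A `&` I01) = mu A.
Proof.
move=> mA AI; elim: n => [|n IHn]; first by congr (mu _); apply/setIidPl.
by rewrite preimage_iterS muT//; exact: measurable_preimage_iter.
Qed.

Lemma ergodic_full A : measurable A -> A `<=` I01 ->
  (forall x, I01 x -> A (T x) <-> A x) -> (0 < mu A)%E -> mu A = 1%E.
Proof.
move=> mA AI invA A0; case: (ergT mA AI) => // [|A00].
  apply/seteqP; split => x /=; first by case=> ATx /invA [] /(_ ATx).
  by move=> Ax; have Ix := AI _ Ax; split=> //; apply/(invA _ Ix).
by rewrite A00 ltxx in A0.
Qed.

Lemma measurable_limsup_preimage (A : (set R)^nat) :
  (forall n, measurable (A n)) ->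
  measurable (lim_sup_set (fun n => iter n T @^-1` A n `&` I01)).
Proof.
move=> mA; apply: bigcapT_measurable => N; apply: bigcup_measurable => n _.
exact: measurable_preimage_iter.
Qed.

(** The limsup set is invariant, and it has measure at least [mu A] because every preimage does;
    ergodicity makes it full. *)
Lemma visits_infinitely_often A : measurable A -> A `<=` I01 -> (0 < mu A)%E ->
  mu (lim_sup_set (fun n => iter n T @^-1` A `&` I01)) = 1%E.
Proof.
move=> mA AI A0; apply: ergodic_full.
- exact: measurable_limsup_preimage.
- by move=> x /(_ 0%N I)[n _ []].
- move=> x Ix; split=> Vx N _.
    have [n /= Nn [An _]] := Vx N I; exists n.+1 => /=; first exact: leqW.
    by split=> //; rewrite /= -iterS iterSr.
  have [[|n]//= Nn [An _]] := Vx N.+1 I; exists n => //=; split.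
    by rewrite /= -iterSr.
  exact: TI.
- apply: (lt_le_trans A0); apply: le_lebesgue_measure_limsup.
  + by move=> n; exact: measurable_preimage_iter.
  + by move=> n; exact: subIsetr.
  + by move=> N; exists N => //; rewrite lebesgue_measure_preimage_iter.
Qed.

(** The preimages of [A] increase and all have measure [mu A], so their union does too; by
    recurrence that union is full. *)
Lemma forward_invariant_full A : measurable A -> A `<=` I01 ->
  (forall x, A x -> A (T x)) -> (0 < mu A)%E -> mu A = 1%E.
Proof.
move=> mA AI fwdA A0; pose F n := iter n T @^-1` A `&` I01.
have mF n : measurable (F n) by exact: measurable_preimage_iter.
have mUF : measurable (\bigcup_n F n) by exact: bigcupT_measurable.
have ndF : nondecreasing_seq F.
  apply/nondecreasing_seqP => n; apply/subsetPset => x [/= Ax Ix].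
  by split=> //=; apply: fwdA.
have /cvg_lim-/(_ (@ereal_hausdorff R)) :=
  nondecreasing_cvg_mu (mu := mu) mF mUF ndF.
rewrite (_ : mu \o F = fun=> mu A); last first.
  by apply/funext => n; exact: lebesgue_measure_preimage_iter.
rewrite lim_cst// => ->; apply/eqP.
rewrite eq_le lebesgue_measure_le1//=; last first.
  by move=> x [n _ []].
rewrite -(visits_infinitely_often mA AI A0); apply: le_measure; rewrite ?inE//.
  exact: measurable_limsup_preimage.
by move=> x /(_ 0%N I)[n _ Fx]; exists n.
Qed.

End unit_interval.

(** * Towers of intervals and the points approached at rate [1 / n] *)

Section towers.
Variable R : realType.
Variable T : R -> R.
Local Notation mu := (@lebesgue_measure R).
Implicit Types (b w x y : R) (h i j n p : nat).

(** In a tower of height above [i] this is the image of [[b, b + w)] under [T^i]; as an interval it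
    is visibly measurable and of length [w]. *)
Definition level b w i : set R := `[iter i T b, iter i T b + w[%classic.

(** A Rokhlin tower over [[b, b + w)] whose levels are translates of the base. *)
Definition is_tower b w h : Prop :=
  [/\ 0 < w,
      (forall i x, (i < h)%N -> b <= x < b + w ->
        I01 (iter i T x) /\ iter i T x = iter i T b + (x - b))
    & forall i j x y, (i < j < h)%N -> b <= x < b + w -> b <= y < b + w ->
        iter i T x <> iter j T y].

Lemma levelP b w h i x : is_tower b w h -> (i < h)%N -> level b w i x ->
  exists2 z, b <= z < b + w & x = iter i T z.
Proof.
case=> w0 tw _ ih; rewrite /level/= in_itv/= => xi.
exists (b + (x - iter i T b)); first by lra.
by have [|_ ->//] := tw i (b + (x - iter i T b)) ih; lra.
Qed.

Lemma level_sub_I01 b w h i : is_tower b w h -> (i < h)%N ->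
  level b w i `<=` I01.
Proof.
move=> tw ih x /(levelP tw ih)[z zb ->].
by case: tw => _ + _ => /(_ _ _ ih zb)[].
Qed.

Lemma level_iter b w h i l x : is_tower b w h -> (i <= l < h)%N ->
  level b w i x -> level b w l (iter (l - i) T x).
Proof.
move=> tw /andP[il lh] /(levelP tw (leq_ltn_trans il lh))[z zb ->].
rewrite -iterD subnK// /level/= in_itv/=.
by case: tw => _ + _ => /(_ _ _ lh zb)[_ ->]; lra.
Qed.

Lemma level_disjoint b w h i j x : is_tower b w h -> (i < j < h)%N ->
  level b w i x -> level b w j x -> False.
Proof.
move=> tw ijh; have /andP[ij jh] := ijh.
move=> /(levelP tw (ltn_trans ij jh))[y yb ->] /(levelP tw jh)[z zb].
by case: tw => _ _; apply; eauto.
Qed.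

Definition slab b w p n : set R := \big[setU/set0]_(i < n) level b w (p + i).

Lemma slabP b w p n x :
  slab b w p n x <-> exists2 i, (p <= i < p + n)%N & level b w i x.
Proof.
rewrite /slab -(bigcup_mkord _ (fun i => level b w (p + i))).
split=> [[i /= ilt]|[i /andP[pi ilt] lx]].
  by exists (p + i)%N => //; rewrite leq_addr ltn_add2l.
by exists (i - p)%N => /=; [lia|rewrite subnKC].
Qed.

Lemma measurable_slab b w p n : measurable (slab b w p n).
Proof. by apply: bigsetU_measurable => i _; exact: measurable_itv. Qed.

Lemma slab_sub_I01 b w h p n : is_tower b w h -> (p + n <= h)%N ->
  slab b w p n `<=` I01.
Proof.
move=> tw pnh x /slabP[i /andP[_ ilt] lx].
exact: (level_sub_I01 tw (leq_trans ilt pnh)) lx.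
Qed.

Lemma lebesgue_measure_slab b w h p n : is_tower b w h -> (p + n <= h)%N ->
  mu (slab b w p n) = (n%:R * w)%:E.
Proof.
move=> tw pnh; have w0 : 0 < w by case: tw.
rewrite /slab.
rewrite (@measure_semi_additive_ord_I _ _ _ mu (fun i => level b w (p + i))).
- rewrite (eq_bigr (fun=> w%:E)) => [|i _]; last first.
    rewrite -[LHS]/(mu (level b w (p + i))) lebesgue_measure_itv/= lte_fin.
    by rewrite ltrDl w0 -EFinB addrAC subrr add0r.
  by rewrite sumEFin sumr_const card_ord mulr_natl.
- by move=> i _; exact: measurable_itv.
- have disj i j : (i < j < n)%N ->
      level b w (p + i) `&` level b w (p + j) = set0.
    move=> ijn; rewrite -subset0 => x [xi xj].
    by apply: (level_disjoint tw _ xi xj); lia.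
  apply/trivIsetP => i j /= iln jln; rewrite neq_ltn => /orP[ij|ji].
    by apply: disj; rewrite ij.
  by rewrite setIC; apply: disj; rewrite ji.
- exact: measurable_slab.
Qed.

Lemma tower_area_le1 b w h : is_tower b w h -> h%:R * w <= 1.
Proof.
move=> tw; rewrite -lee_fin -(lebesgue_measure_slab (p := 0) tw)//.
apply: lebesgue_measure_le1; first exact: measurable_slab.
exact: slab_sub_I01 tw _.
Qed.

(* Shifting the time by an arbitrary [p] makes this set invariant under [T],
   at the price of the factor 2 between [n^-1] and [2 / (n + p)]. *)
Definition approach y : set R := \bigcup_p
  lim_sup_set (fun n => iter (n + p) T @^-1` ball y n%:R^-1 `&` I01).

Hypothesis TI : forall x, I01 x -> I01 (T x).
Hypothesis mT : forall A, measurable A -> measurable (T @^-1` A `&` I01).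
Hypothesis muT : forall A, measurable A -> A `<=` I01 ->
  mu (T @^-1` A `&` I01) = mu A.
Hypothesis ergT : ergodic_leb T.

Lemma measurable_approach y : measurable (approach y).
Proof.
apply: bigcupT_measurable => p; apply: bigcapT_measurable => N.
apply: bigcup_measurable => n _; apply: measurable_preimage_iter => //.
exact: measurable_ball.
Qed.

Lemma approach_sub_I01 y : approach y `<=` I01.
Proof. by move=> x [p _ /(_ 0%N I)[n _ []]]. Qed.

Lemma approach_invariant y x : I01 x -> approach y (T x) <-> approach y x.
Proof.
move=> Ix; split=> -[p _ apx].
  exists p.+1 => // N _; have [n /= Nn [yn _]] := apx N I; exists n => //=.
  by split=> //; rewrite /= addnS iterSr.
(* Here the time [n.+1] becomes [n], and the radius only grows. The bound [N.+2] keeps [n] positive,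
   since [0^-1] is [0]. *)
exists p => // N _; have [n /= Nn [yn _]] := apx N.+2 I.
case: n => [//|n] in Nn yn *; exists n; first by move: Nn => /=; lia.
split; last exact: TI.
rewrite /= -iterSr -addSn; apply: le_ball yn.
by rewrite lef_pV2 ?posrE ?ltr0n ?ler_nat//; lia.
Qed.

Lemma approach_full y : (0 < mu (approach y))%E -> mu (approach y) = 1%E.
Proof.
apply: (ergodic_full ergT) => //; first exact: measurable_approach.
  exact: approach_sub_I01.
by move=> x; exact: approach_invariant.
Qed.

(** * A sequence of towers of area at least [c] with widths tending to 0 *)

Variables (c : R) (b w : nat -> R) (h : nat -> nat).
Hypothesis c0 : 0 < c.
Hypothesis tw : forall m, is_tower (b m) (w m) (h m).
Hypothesis cw : forall m, c <= (h m)%:R * w m.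
Hypothesis wsmall : forall m, w m <= m.+1%:R^-1.

Lemma tower_height_gt0 m : (0 < h m)%N.
Proof.
by rewrite lt0n; apply/eqP => h0; have := cw m; rewrite h0 mul0r leNgt c0.
Qed.

(** Area at least [c] and width at most [1 / (m + 1)] force [h m >= c * (m + 1)]. *)
Lemma tower_height_unbounded n : exists M, forall m, (M <= m)%N -> (n <= h m)%N.
Proof.
exists (Num.truncn (n%:R / c)) => m Mm; rewrite -(ler_nat R).
have w0 : 0 < w m by case: (tw m).
have nm : n%:R / c < m.+1%:R.
  by apply: (lt_le_trans (truncnS_gt _)); rewrite ler_nat.
have : n%:R * w m <= (h m)%:R * w m.
  apply: le_trans (cw m); rewrite ltr_pdivrMr// in nm.
  rewrite -ler_pdivlMr//; apply: (le_trans (ltW nm)).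
  rewrite mulrC ler_pM2l// -[leLHS]invrK lef_pV2 ?posrE ?invr_gt0//.
by rewrite ler_pM2r.
Qed.

(** Climbing from the lower slab to the upper one takes at least [h m %/ 4] steps, while each slab
    keeps a fixed share of the area; the [.+1] makes up for the rounding in the quarter. *)
Definition lower_slab m := slab (b m) (w m) 0 (h m %/ 4).+1.
Definition upper_slab m := slab (b m) (w m) (h m %/ 2) (h m - h m %/ 2).

Lemma lower_slab_ge m : ((c / 4)%:E <= mu (lower_slab m))%E.
Proof.
have h0 := tower_height_gt0 m; have w0 : 0 < w m by case: (tw m).
rewrite (lebesgue_measure_slab (tw m)); last by lia.
rewrite lee_fin ler_pdivrMr//; apply: (le_trans (cw m)).
rewrite mulrAC ler_pM2r// -natrM ler_nat; lia.
Qed.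

Lemma upper_slab_ge m : ((c / 2)%:E <= mu (upper_slab m))%E.
Proof.
have w0 : 0 < w m by case: (tw m).
rewrite (lebesgue_measure_slab (tw m)); last by lia.
rewrite lee_fin ler_pdivrMr//; apply: (le_trans (cw m)).
rewrite mulrAC ler_pM2r// -natrM ler_nat; lia.
Qed.

(** If [x] is in level [i] and [y] in level [l], then [T^(l - i) x] shares the level of [y], of
    width at most [1 / h m], hence at most [1 / (l - i)]. *)
Lemma slab_approach m x y N : (0 < N)%N -> (4 * N <= h m)%N ->
  lower_slab m x -> upper_slab m y ->
  exists2 n, (N <= n)%N & ball y n%:R^-1 (iter n T x).
Proof.
move=> N0 Nh /slabP[i ib xi] /slabP[l lb yl]; exists (l - i)%N; first by lia.
have h0 := tower_height_gt0 m; have w0 : 0 < w m by case: (tw m).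
have : level (b m) (w m) l (iter (l - i) T x).
  by apply: level_iter (tw m) _ xi; lia.
move: yl; rewrite /level/= !in_itv/= => yl xl.
have li0 : (0 < (l - i)%:R :> R) by rewrite ltr0n; lia.
have : w m <= (l - i)%:R^-1.
  rewrite -[leRHS]mul1r ler_pdivlMr//.
  apply: le_trans (tower_area_le1 (tw m)).
  by rewrite mulrC ler_pM2r// ler_nat; lia.
by apply: lt_le_trans; rewrite ltr_norml; lra.
Qed.

Lemma upper_slab_approach_full y :
  lim_sup_set upper_slab y -> mu (approach y) = 1%E.
Proof.
move=> Uy; apply: approach_full.
have c40 : (0 < (c / 4)%:E)%E by rewrite lte_fin divr_gt0.
apply: (lt_le_trans c40).
(* Emptying [A m] when [y] misses the upper slab replaces the extraction of a subsequence: only good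
   indices enter the limsup. *)
pose A m : set R := if `[< upper_slab m y >] then lower_slab m else set0.
have mA m : measurable (A m).
  by rewrite /A; case: ifP => _ //; exact: measurable_slab.
have AI m : A m `<=` I01.
  rewrite /A; case: ifP => _; last by [].
  by apply: slab_sub_I01 (tw m) _; have := tower_height_gt0 m; lia.
have cA : ((c / 4)%:E <= mu (lim_sup_set A))%E.
  apply: le_lebesgue_measure_limsup => // N; have [m /= Nm Um] := Uy N I.
  by exists m => //; rewrite /A asboolT//; exact: lower_slab_ge.
apply: (le_trans cA); apply: le_measure; rewrite ?inE//.
- apply: bigcapT_measurable => N; apply: bigcup_measurable => m _; exact: mA.
- exact: measurable_approach.
move=> x Ax; exists 0%N => // N _.
have [M Mh] := tower_height_unbounded (4 * N.+1).
have [m /= Mm Amx] := Ax M I.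
have Ix := AI m _ Amx; move: Amx; rewrite /A; case: asboolP => // Um Lm.
have [n Nn yn] := slab_approach (ltn0Sn N) (Mh _ Mm) Lm Um.
by exists n => /=; [exact: ltnW|rewrite addn0].
Qed.

Lemma exists_approach_full : exists Y : set R,
  [/\ measurable Y, Y `<=` I01, (0 < mu Y)%E
    & forall y, Y y -> mu (approach y) = 1%E].
Proof.
exists (lim_sup_set upper_slab); split.
- apply: bigcapT_measurable => N; apply: bigcup_measurable => m _.
  exact: measurable_slab.
- by move=> x /(_ 0%N I)[m _ Um]; apply: (slab_sub_I01 (tw m) _ Um); lia.
- have c20 : (0 < (c / 2)%:E)%E by rewrite lte_fin divr_gt0.
  apply: (lt_le_trans c20); apply: le_lebesgue_measure_limsup.
  + by move=> m; exact: measurable_slab.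
  + by move=> m; apply: slab_sub_I01 (tw m) _; lia.
  + by move=> N; exists N => //; exact: upper_slab_ge.
- exact: upper_slab_approach_full.
Qed.

End towers.

(** * Interval exchanges: translation on pieces, invariance of Lebesgue measure, local isometry *)

Section interval_exchange.
Variable R : realType.
Variable T : R -> R.
Local Notation mu := (@lebesgue_measure R).
Variables (k : nat) (a t : nat -> R).
Hypothesis a0 : a 0%N = 0.
Hypothesis ak : a k = 1.
Hypothesis a_lt : forall i, (i < k)%N -> a i < a i.+1.
Hypothesis aT : forall i x, (i < k)%N -> a i <= x < a i.+1 -> T x = x + t i.
Hypothesis bijT : set_bij I01 I01 T.

Lemma iet_I01 x : I01 x -> I01 (T x).
Proof. by case: bijT => + _ _; exact. Qed.

Lemma iet_inj x y : I01 x -> I01 y -> T x = T y -> x = y.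
Proof.
by case: bijT => _ inj _ Ix Iy; apply: inj; rewrite inE.
Qed.

Lemma iter_iet_inj n x y : I01 x -> I01 y -> iter n T x = iter n T y -> x = y.
Proof.
move=> Ix Iy; elim: n => //= n IHn; move=> /iet_inj eqT; apply: IHn.
by apply: eqT; apply: iter_I01 => //; exact: iet_I01.
Qed.

Lemma pieces_gt0 : (0 < k)%N.
Proof.
rewrite lt0n; apply/eqP => k0; move: ak; rewrite k0 a0 => /eqP.
by rewrite eq_sym oner_eq0.
Qed.

Lemma break_le1 i : (i <= k)%N -> a i <= 1.
Proof.
elim: {i}(k - i)%N {-2}i (erefl (k - i)%N) => [|n IHn] i ni ik.
  by rewrite (_ : i = k) ?ak//; lia.
have ik' : (i < k)%N by lia.
by apply: (le_trans (ltW (a_lt ik'))); apply: IHn; lia.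
Qed.

Lemma break_ge0 i : (i <= k)%N -> 0 <= a i.
Proof.
elim: i => [|i IHi] ik; first by rewrite a0.
exact: le_trans (IHi (ltnW ik)) (ltW (a_lt ik)).
Qed.

Lemma piece_exists x : I01 x -> exists2 i, (i < k)%N & a i <= x < a i.+1.
Proof.
move=> /andP[x0 x1]; have ex : exists i, x < a i by exists k; rewrite ak.
case: (ex_minnP ex) => -[|i] xi min; first by move: xi; rewrite a0 ltNge x0.
exists i; first by apply: min; rewrite ak.
by rewrite xi andbT leNgt; apply/negP => /min; rewrite ltnn.
Qed.

Lemma piece_sub_I01 i x : (i < k)%N -> a i <= x < a i.+1 -> I01 x.
Proof.
move=> ik /andP[ax xa]; apply/andP; split.
  exact: le_trans (break_ge0 (ltnW ik)) ax.
exact: lt_le_trans xa (break_le1 ik).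
Qed.

(** With no break point in []x, y]], both points lie in the same piece. *)
Lemma iet_translation x y : I01 x -> I01 y -> x <= y ->
  (forall i, (i < k)%N -> ~ (x < a i <= y)) -> T y = T x + (y - x).
Proof.
move=> Ix Iy xy nobreak; have [i ik /andP[ax xa]] := piece_exists Ix.
have ya : y < a i.+1.
  rewrite ltNge; apply/negP => ay; have [ik'|ki] := ltnP i.+1 k.
    by apply: (nobreak _ ik'); rewrite xa ay.
  (* The right end of the last piece is not among the break points with index below [k]; it is [1],
     and [y < 1]. *)
  have iE : i.+1 = k by lia.
  by move: ay Iy; rewrite iE ak => + /andP[_]; rewrite leNgt => /negbTE ->.
by rewrite (aT ik (_ : a i <= x < _)) ?ax// (aT ik (_ : a i <= y < _)); lra.
Qed.

Definition piece_preimage (A : set R) i : set R :=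
  `[a i, a i.+1[%classic `&` [set x | A (x + t i)].

Lemma iet_preimageE A :
  T @^-1` A `&` I01 = \big[setU/set0]_(i < k) piece_preimage A i.
Proof.
rewrite -(bigcup_mkord k (piece_preimage A)).
apply/seteqP; split => x [].
  move=> Ax Ix; have [i ik xi] := piece_exists Ix; exists i => //; split.
    by rewrite /= in_itv.
  by rewrite /= -(aT ik xi).
move=> i /= ik []; rewrite /= in_itv/= => xi Ax; split.
  by rewrite /= (aT ik xi).
exact: piece_sub_I01 xi.
Qed.

Lemma measurable_piece_preimage A i :
  measurable A -> measurable (piece_preimage A i).
Proof.
move=> mA; apply: measurableI; first exact: measurable_itv.
have mf : measurable_fun setT (fun x : R => x + t i).
  by apply: continuous_measurable_fun => x; apply: cvgD => //; exact: cvg_cst.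
by rewrite -[X in measurable X]setTI; exact: mf.
Qed.

Lemma measurable_iet_preimage A :
  measurable A -> measurable (T @^-1` A `&` I01).
Proof.
move=> mA; rewrite iet_preimageE; apply: bigsetU_measurable => i _.
exact: measurable_piece_preimage.
Qed.

(** Each piece of the preimage is moved by its translation onto a part [Q i] of [A]. Surjectivity of
    [T] makes the [Q i] cover [A], injectivity makes them disjoint. *)
Lemma lebesgue_measure_iet_preimage A : measurable A -> A `<=` I01 ->
  mu (T @^-1` A `&` I01) = mu A.
Proof.
move=> mA AI.
pose Q i : set R := [set x | piece_preimage A i (x - t i)].
have QE i : Q i = `[a i + t i, a i.+1 + t i[%classic `&` A.
  apply/seteqP; split => x /=; rewrite /Q/piece_preimage/= !in_itv/= subrK.
    by case=> xi Ax; split=> //; lra.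
  by case=> xi Ax; split=> //; lra.
have mQ i : measurable (Q i).
  by rewrite QE; apply: measurableI => //; exact: measurable_itv.
have QP i x : (i < k)%N -> Q i x ->
    exists z, [/\ a i <= z < a i.+1, I01 z & T z = x].
  move=> ik; rewrite /Q/piece_preimage/= in_itv/= => -[xi _].
  exists (x - t i); split => //; first exact: piece_sub_I01 xi.
  by rewrite (aT ik xi) subrK.
have disj (F : nat -> set R) :
    (forall i j x, (i < j < k)%N -> F i x -> F j x -> False) ->
    trivIset `I_k F.
  move=> FF; apply/trivIsetP => i j /= ik jk; rewrite neq_ltn => /orP[ij|ji];
    rewrite -subset0 => x [Fi Fj].
    by apply: (FF i j x) Fi Fj; rewrite ij.
  by apply: (FF j i x) Fj Fi; rewrite ji.
have monoa i j : (i < j < k)%N -> a i.+1 <= a j.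
  elim: j => [|j IHj] /andP[ij jk]; first by [].
  have [->//|ij'] := eqVneq i j; apply: (le_trans (IHj _)); first by lia.
  by apply/ltW/a_lt; lia.
rewrite iet_preimageE.
rewrite (@measure_semi_additive_ord_I _ _ _ mu (piece_preimage A)); first last.
- by apply: bigsetU_measurable => i _; exact: measurable_piece_preimage.
- apply: disj => i j x ijk.
  rewrite /piece_preimage/= !in_itv/= => -[xi _] [xj _].
  by have := monoa _ _ ijk; lra.
- by move=> i _; exact: measurable_piece_preimage.
have AE : A = \big[setU/set0]_(i < k) Q i.
  rewrite -(bigcup_mkord k Q); apply/seteqP; split => x; last first.
    by case=> i _; rewrite QE => -[].
  move=> Ax; case: bijT => _ _ /(_ _ (AI _ Ax))[z Iz Tz].
  have [i ik zi] := piece_exists Iz; exists i => //.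
  by rewrite QE; split=> //=; rewrite in_itv/= -Tz (aT ik zi); lra.
rewrite [in RHS]AE (@measure_semi_additive_ord_I _ _ _ mu Q); first last.
- by apply: bigsetU_measurable => i _; exact: mQ.
- apply: disj => i j x ijk Qi Qj.
  have [ik jk] : (i < k)%N /\ (j < k)%N by lia.
  have [z [zi Iz zx]] := QP i x ik Qi; have [z' [zj Iz' zx']] := QP j x jk Qj.
  have zz' : z = z' by apply: iet_inj; rewrite ?zx.
  by have := monoa _ _ ijk; rewrite -zz' in zj; lra.
- by move=> i _; exact: mQ.
apply: eq_bigr => i _; rewrite -[LHS]/(mu _) -[RHS]/(mu _).
rewrite -(lebesgue_measure_preimage_addr (t i) (mQ i)).
suff -> : [set x | Q i (x + t i)] = piece_preimage A i by [].
by apply/funext => x; rewrite /Q /mkset addrK.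
Qed.

(** An orbit avoiding the break points stays interior to the pieces; [e] is the smallest margin over
    the first [m] steps. *)
Lemma iter_iet_translation m y : I01 y ->
  (forall n i, (i < k)%N -> iter n T y <> a i) ->
  exists2 e, 0 < e & forall z, `|z| < e ->
    I01 (y + z) /\ iter m T (y + z) = iter m T y + z.
Proof.
move=> Iy avoid; have k0 := pieces_gt0.
elim: m => [|m [e e0 IHm]].
  (* [a 0 = 0] is among the avoided points, so [y] is interior to [[0, 1)]. *)
  have y0 : y != 0 by apply/eqP => y0; apply: (avoid 0%N 0%N k0); rewrite a0.
  have /andP[yge0 y1] := Iy; have ygt0 : 0 < y by rewrite lt_def y0.
  exists (Num.min y (1 - y)); first by rewrite lt_min ygt0 subr_gt0.
  move=> z; rewrite lt_min !ltr_norml => zy; split=> //.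
  by apply/andP; lra.
have [i ik /andP[ai ia]] := piece_exists (iter_I01 iet_I01 m Iy).
have ai' : a i < iter m T y.
  by rewrite lt_neqAle ai andbT; apply/eqP => /esym/avoid; exact.
exists (Num.min e (Num.min (iter m T y - a i) (a i.+1 - iter m T y))).
  by rewrite !lt_min e0 !subr_gt0 ai' ia.
move=> z; rewrite !lt_min => /andP[ze]; rewrite !ltr_norml => zi.
have [Iyz yz] := IHm _ ze; split=> //=.
by rewrite yz (aT ik) 1?(aT (x := iter m T y) ik); lra.
Qed.

(** A point [T^(n + p) x] close to [T^m y] is [T^m (y + z)] with [z] small; injectivity gives
    [T^(n - m + p) x = y + z], and [1 / n <= 1 / (n - m)]. *)
Lemma approach_iter m y : I01 y ->
  (forall n i, (i < k)%N -> iter n T y <> a i) ->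
  approach T (iter m T y) `<=` approach T y.
Proof.
move=> Iy avoid x [p _ apx]; exists p => // N _.
have [e e0 trans] := iter_iet_translation m Iy avoid.
have [M eM] : exists M : nat, e^-1 < M.+1%:R.
  by exists (Num.truncn e^-1); exact: truncnS_gt.
(* [N + m] ensures [n - m >= N]; [M.+1] ensures [1 / n < e] and [n - m > 0]. *)
have [n /= Nn [yn Ix]] := apx (N + m + M.+1)%N I.
exists (n - m)%N => /=; first by lia.
split=> //.
have n0 : (0 < n - m)%N by lia.
pose z := iter (n + p) T x - iter m T y.
have nz : `|z| < n%:R^-1 by rewrite distrC.
have [|Iyz yz] := trans z.
  apply: (lt_trans nz); rewrite invf_plt ?posrE ?ltr0n//; last by lia.
  by apply: (lt_le_trans eM); rewrite ler_nat; lia.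
have -> : iter (n - m + p) T x = y + z.
  apply: (@iter_iet_inj m) => //; first exact: iter_I01 iet_I01 _ _ Ix.
  rewrite yz -iterD [RHS]addrC subrK; congr (iter _ T x); lia.
rewrite /ball/= opprD addNKr normrN; apply: (lt_le_trans nz).
rewrite lef_pV2 ?posrE ?ltr0n ?ler_nat//; lia.
Qed.

End interval_exchange.

(** * The first return to [[0, v)] and the towers over it *)

Section return_towers.
Variable R : realType.
Variable T : R -> R.
Local Notation mu := (@lebesgue_measure R).
Variables (k : nat) (a t : nat -> R).
Hypothesis a0 : a 0%N = 0.
Hypothesis ak : a k = 1.
Hypothesis a_lt : forall i, (i < k)%N -> a i < a i.+1.
Hypothesis aT : forall i x, (i < k)%N -> a i <= x < a i.+1 -> T x = x + t i.
Hypothesis bijT : set_bij I01 I01 T.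
Hypothesis ergT : ergodic_leb T.
Variable v : R.
Hypothesis v01 : 0 < v < 1.

Let TI := iet_I01 bijT.
Let mT := measurable_iet_preimage a0 ak a_lt aT.
Let muT := lebesgue_measure_iet_preimage a0 ak a_lt aT bijT.

(** Obstacles to translating an interval up to its return: a break point may split it, and the end
    [v] of the base may separate returning from non-returning points. Index [k] stands for [v]. *)
Definition mark (i : nat) : R := if (i < k)%N then a i else v.

(* [T^n c] reaches the mark [p] before the orbit of [c] returns to [[0, v)]. *)
Definition is_cut (c p : R) : Prop := 0 <= c < v /\
  exists2 n, (forall j, (0 < j <= n)%N -> v <= iter j T c) & iter n T c = p.

Lemma base_I01 x : 0 <= x < v -> I01 x.
Proof. by have := v01; move=> ? ?; apply/andP; lra. Qed.

(* If [T^n c = T^m d] with [n < m], then [c = T^(m - n) d] would be an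
   intermediate return of [d] to [[0, v)]. *)
Lemma is_cut_unique c d p : is_cut c p -> is_cut d p -> c = d.
Proof.
suff wl c' d' n m : (n <= m)%N -> 0 <= c' < v -> 0 <= d' < v ->
    (forall j, (0 < j <= m)%N -> v <= iter j T d') ->
    iter n T c' = iter m T d' -> c' = d'.
  move=> [cv [n nc cp]] [dv [m md dp]].
  have [nm|/ltnW mn] := leqP n m; first by apply: (wl _ _ n m); rewrite // cp.
  by apply/esym; apply: (wl _ _ m n); rewrite // cp.
move=> nm cv dv md cd.
have cE : c' = iter (m - n) T d'.
  apply: (iter_iet_inj bijT (n := n)); [exact: base_I01| |].
    exact: iter_I01 TI _ _ (base_I01 dv).
  by rewrite -iterD subnKC.
have [mn0|mn0] := posnP (m - n); first by rewrite cE mn0.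
have vc : v <= c' by rewrite cE; apply: md; rewrite mn0 leq_subr.
by move: cv; rewrite ltNge vc andbF.
Qed.

(* If no cut leads to [mark i], this is the default [0], itself a cut. *)
Definition cut (i : 'I_k.+1) : R := xget 0 [set c | is_cut c (mark i)].

Lemma cut_in i : 0 <= cut i < v.
Proof.
rewrite /cut; case: xgetP => [c _ []//|_].
by case/andP: v01 => v0 _; rewrite lexx v0.
Qed.

Lemma is_cutE c (i : 'I_k.+1) : is_cut c (mark i) -> c = cut i.
Proof.
move=> cc; rewrite /cut; case: xgetP => [d _ dc|/(_ c)//].
exact: is_cut_unique cc dc.
Qed.

(** [mark 0] is [a 0 = 0], reached at time 0. Thus every point of the base has a cut at or to the
    left of it. *)
Lemma cut0 : cut ord0 = 0.
Proof.
apply/esym/is_cutE; split; first by case/andP: v01 => v0 _; rewrite lexx v0.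
by exists 0%N => [[]//|]; rewrite /mark (pieces_gt0 a0 ak) a0.
Qed.

(** The gap from [cut i] to the next cut on its right, or to [v] if there is none; the subtraction
    is outside the minimum. Equal cuts give the same interval, which is harmless for a cover. *)
Definition width (i : 'I_k.+1) : R :=
  \big[Order.min/v]_(j < k.+1 | cut i < cut j) cut j - cut i.

Lemma width_gt0 i : 0 < width i.
Proof.
rewrite subr_gt0; apply/bigmin_gtP; split=> //.
by case/andP: (cut_in i).
Qed.

Lemma cut_width_le i : cut i + width i <= v.
Proof. by rewrite /width addrC subrK; exact: bigmin_le_id. Qed.

Lemma no_cut_inside i j : ~ (cut i < cut j < cut i + width i).
Proof.
move=> /andP[ij]; rewrite /width addrC subrK => /bigmin_gtP[_ /(_ j ij)].
by rewrite ltxx.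
Qed.

Lemma base_cover x : 0 <= x < v -> exists i, cut i <= x < cut i + width i.
Proof.
move=> xv; have /andP[x0 xlt] := xv.
have P0 : cut ord0 <= x by rewrite cut0.
case: (@Order.TotalTheory.arg_maxP _ _ _ ord0 (fun i => cut i <= x) cut P0).
move=> i ix imax; exists i; rewrite ix /width addrC subrK; apply/bigmin_gtP.
split=> // j ij; rewrite ltNge; apply/negP => jx.
by have : cut j <= cut i := imax j jx; rewrite leNgt ij.
Qed.

Lemma base_sub_I01 i x : cut i <= x < cut i + width i -> 0 <= x < v.
Proof. by have := cut_in i; have := cut_width_le i; lra. Qed.

(** Induction on [n]: a break point separating [T^n (cut i)] from [T^n x] would be reached from a
    point strictly inside the interval, which would then be a cut. *)
Lemma iter_base i n x :
  (forall j, (0 < j < n)%N -> v <= iter j T (cut i)) ->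
  cut i <= x < cut i + width i ->
  iter n T x = iter n T (cut i) + (x - cut i) /\
  (forall j, (0 < j < n)%N -> v <= iter j T x).
Proof.
elim: n x => [|n IHn] x noret xi.
  by split=> [|[]//]; rewrite /= addrC subrK.
have noret' j : (0 < j < n)%N -> v <= iter j T (cut i).
  by move=> /andP[j0 jn]; apply: noret; rewrite j0 ltnW.
(* Iterates of [y] lie at or to the right of those of [cut i], which are at least [v]. *)
have far y j : cut i <= y < cut i + width i -> (0 < j <= n)%N ->
    v <= iter j T y.
  move=> yi /andP[j0]; have [yn yj] := IHn y noret' yi.
  rewrite leq_eqVlt => /predU1P[jn|jn]; last by apply: yj; rewrite j0.
  have : v <= iter n T (cut i) by apply: noret; rewrite -jn j0 /=.
  by rewrite jn yn; lra.
split; last by move=> j /= jn; exact: far.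
have cuti : cut i <= cut i < cut i + width i by have := width_gt0 i; lra.
have Inx y : cut i <= y < cut i + width i -> I01 (iter n T y).
  by move=> yi; apply: iter_I01 TI _ _ (base_I01 (base_sub_I01 yi)).
have [xn _] := IHn x noret' xi.
rewrite /= (iet_translation a0 ak aT (Inx _ cuti) (Inx _ xi)).
- by rewrite xn addrAC subrr add0r.
- by rewrite xn; lra.
move=> j jk abetween; pose c := cut i + (a j - iter n T (cut i)).
have ci : cut i < c < cut i + width i.
  by rewrite xn in abetween; rewrite /c; lra.
have ci' : cut i <= c < cut i + width i by lra.
have jk1 : (j < k.+1)%N by exact: ltnW.
apply: (@no_cut_inside i (Ordinal jk1)); rewrite -(@is_cutE c (Ordinal jk1))//.
split; first exact: base_sub_I01 ci'.
exists n; first by move=> l; exact: far.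
by have [-> _] := IHn c noret' ci'; rewrite /mark /= jk /c; lra.
Qed.

(** If [x] failed to return together with [cut i], some [c] in []cut i, x]] would satisfy
    [T^n c = v] and be a cut for the mark [v]. *)
Lemma return_base i n x : (0 < n)%N ->
  (forall j, (0 < j < n)%N -> v <= iter j T (cut i)) ->
  iter n T (cut i) < v ->
  cut i <= x < cut i + width i -> iter n T x < v.
Proof.
move=> n0 noret ret xi; rewrite ltNge; apply/negP => vx.
have [xn _] := iter_base noret xi.
pose c := cut i + (v - iter n T (cut i)).
have ci : cut i < c < cut i + width i by rewrite xn in vx; rewrite /c; lra.
have ci' : cut i <= c < cut i + width i by lra.
have [cn cfar] := iter_base noret ci'.
have cv : iter n T c = v by rewrite cn /c; lra.
apply: (@no_cut_inside i ord_max); rewrite -(@is_cutE c ord_max)//.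
split; first exact: base_sub_I01 ci'.
exists n; last by rewrite cv /mark /= ltnn.
move=> j /andP[j0]; rewrite leq_eqVlt => /predU1P[->|jn]; first by rewrite cv.
by apply: cfar; rewrite j0.
Qed.

(** If [cut i] never returned, its whole interval would stay outside [[0, v)] forever, against
    recurrence. *)
Lemma return_exists i : exists n, (0 < n)%N && (iter n T (cut i) < v).
Proof.
apply/not_existsP => noret.
have far j : (0 < j)%N -> v <= iter j T (cut i).
  by move=> j0; rewrite leNgt; apply/negP => jv; apply: (noret j); rewrite j0.
pose B : set R := `[cut i, cut i + width i[%classic.
have mB : measurable B by exact: measurable_itv.
have BI : B `<=` I01.
  by move=> x; rewrite /B/= in_itv/= => /base_sub_I01; exact: base_I01.
have muB : (0 < mu B)%E.
  rewrite lebesgue_measure_itv/= lte_fin ltrDl width_gt0 -EFinB lte_fin.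
  by rewrite addrAC subrr add0r width_gt0.
have V1 := visits_infinitely_often TI mT muT ergT mB BI muB.
have [x Vx] : lim_sup_set (fun n => iter n T @^-1` B `&` I01) !=set0.
  apply/set0P; apply: contra_eq_neq V1 => ->.
  by rewrite measure0 eq_sym onee_neq0.
(* Two visits to [B] at times [n < m] make [T^n x] a point of [B] that returns after [m - n]
   steps. *)
have [n _ [Bn _]] := Vx 0%N I; have [m /= nm [Bm _]] := Vx n.+1 I.
move: Bn Bm; rewrite /B/= !in_itv/= => Bn Bm.
have mn0 : (0 < m - n)%N by rewrite subn_gt0.
have [//|_ /(_ (m - n)%N)] := @iter_base i (m - n).+1 (iter n T x) _ Bn.
  by move=> j /andP[j0 _]; exact: far.
rewrite mn0 leqnn => /(_ isT); rewrite -iterD subnK 1?ltnW//.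
by have := base_sub_I01 Bm; lra.
Qed.

Definition return_time i : nat := ex_minn (return_exists i).

Lemma return_timeP i : [/\ (0 < return_time i)%N,
    iter (return_time i) T (cut i) < v
  & forall j, (0 < j < return_time i)%N -> v <= iter j T (cut i)].
Proof.
rewrite /return_time; case: ex_minnP => n /andP[n0 ret] min; split=> //.
move=> j /andP[j0 jn]; rewrite leNgt; apply/negP => jv.
by have := min j; rewrite j0 jv leqNgt jn => /(_ isT).
Qed.

(** Levels are disjoint because [T^n x = T^m y] with [n < m] gives [x = T^(m - n) y], too early a
    return of [y]. *)
Lemma return_tower i : is_tower T (cut i) (width i) (return_time i).
Proof.
have [r0 ret noret] := return_timeP i.
have noret' n : (n <= return_time i)%N ->
    forall j, (0 < j < n)%N -> v <= iter j T (cut i).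
  by move=> nr j /andP[j0 jn]; apply: noret; rewrite j0 (leq_trans jn).
split; first exact: width_gt0.
  move=> n x nr xi; split; last by case: (iter_base (noret' _ (ltnW nr)) xi).
  exact: iter_I01 TI _ _ (base_I01 (base_sub_I01 xi)).
move=> n m x y /andP[nm mr] xi yi xy.
have xE : x = iter (m - n) T y.
  apply: (iter_iet_inj bijT (n := n)).
  - exact: base_I01 (base_sub_I01 xi).
  - exact: iter_I01 TI _ _ (base_I01 (base_sub_I01 yi)).
  - by rewrite -iterD subnKC// ltnW.
have [_ /(_ (m - n)%N)] := iter_base noret yi.
rewrite subn_gt0 nm (leq_ltn_trans (leq_subr _ _) mr) -xE => /(_ isT).
by have := base_sub_I01 xi; lra.
Qed.

(** The union is forward invariant: [T] sends each level to the next, and a top level into [[0, v)],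
    which the bases cover. *)
Lemma return_towers_full :
  mu (\big[setU/set0]_(i < k.+1)
    slab T (cut i) (width i) 0 (return_time i)) = 1%E.
Proof.
pose S i := slab T (cut i) (width i) 0 (return_time i).
have mS i : measurable (S i) by exact: measurable_slab.
have SI i : S i `<=` I01 by exact: slab_sub_I01 (return_tower i) _.
have bigP x : (\big[setU/set0]_(i < k.+1) S i) x <-> exists i, S i x.
  rewrite -bigcup_seq; split=> [[i _ Six]|[i Six]]; exists i => //=.
  exact: mem_index_enum.
apply: (forward_invariant_full TI mT muT ergT).
- by apply: bigsetU_measurable => i _; exact: mS.
- by move=> x /bigP[i]; exact: SI.
- move=> x /bigP[i /slabP[n /= nr xn]]; apply/bigP.
  have tw := return_tower i; have [r0 ret noret] := return_timeP i.
  have [nr'|rn] := ltnP n.+1 (return_time i).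
    exists i; apply/slabP; exists n.+1 => //=.
    have := level_iter (l := n.+1) tw _ xn; rewrite subSnn; apply.
    by rewrite leqnSn.
  have nE : n.+1 = return_time i by lia.
  have [z zi ->] := levelP tw nr xn.
  have zv : 0 <= iter n.+1 T z < v.
    rewrite {2}nE (return_base r0 noret ret zi) andbT.
    by case/andP: (iter_I01 TI n.+1 (base_I01 (base_sub_I01 zi))).
  have [j zj] := base_cover zv; exists j; apply/slabP; exists 0%N.
    by have [] := return_timeP j.
  by rewrite /level/= in_itv.
- have [r0 _ _] := return_timeP ord0.
  apply: (@lt_le_trans _ _ (mu (S ord0))).
    rewrite (lebesgue_measure_slab (return_tower _))// lte_fin.
    by rewrite mulr_gt0 ?ltr0n ?width_gt0.
  apply: le_measure; rewrite ?inE; first exact: mS.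
    by apply: bigsetU_measurable => i _; exact: mS.
  by move=> x Sx; apply/bigP; exists ord0.
Qed.

(** Pigeonhole: if all [k + 1] areas were below [1 / (k + 1)], subadditivity would give the union
    measure below 1. *)
Lemma exists_tower : exists b w h,
  [/\ is_tower T b w h, k.+1%:R^-1 <= h%:R * w & w <= v].
Proof.
suff [i ki] : exists i, k.+1%:R^-1 <= (return_time i)%:R * width i.
  exists (cut i), (width i), (return_time i); split => //.
    exact: return_tower.
  by have := cut_width_le i; have := cut_in i; lra.
apply/not_existsP => small.
have := return_towers_full; apply/eqP; rewrite lt_eqF//.
apply: (@le_lt_trans _ _ (\sum_(i < k.+1) ((return_time i)%:R * width i)%:E)%E).
  pose P (A : set R) s := measurable A /\ (mu A <= s)%E.
  suff [] : P
    (\big[setU/set0]_(i < k.+1) slab T (cut i) (width i) 0 (return_time i))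
    (\sum_(i < k.+1) ((return_time i)%:R * width i)%:E)%E by [].
  apply: (big_rec2 P) => [|i s A _ [mA As]]; first by rewrite /P measure0.
  split; first by apply: measurableU => //; exact: measurable_slab.
  rewrite -(lebesgue_measure_slab (return_tower i) (leqnn (0 + return_time i))).
  apply: le_trans (leeD2l _ As); apply: measureU2 => //; exact: measurable_slab.
rewrite sumEFin lte_fin; apply: (@lt_le_trans _ _ (\sum_(i < k.+1) k.+1%:R^-1)).
  apply: ltr_sum; first by apply/hasP; exists ord0; rewrite ?mem_index_enum.
  by move=> i _; rewrite ltNge; apply/negP/small.
by rewrite sumr_const card_ord -[leLHS]mulr_natr mulVf ?pnatr_eq0.
Qed.

End return_towers.

(** * From approach at rate [1 / n] to the Borel-Cantelli property *)

Section shrinking_targets.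
Variable R : realType.
Variable T : R -> R.
Local Notation mu := (@lebesgue_measure R).
Hypothesis TI : forall x, I01 x -> I01 (T x).
Hypothesis mT : forall A, measurable A -> measurable (T @^-1` A `&` I01).
Hypothesis muT : forall A, measurable A -> A `<=` I01 ->
  mu (T @^-1` A `&` I01) = mu A.
Variables (y : R) (r : nat -> R).

Lemma limsup_preimE :
  limsup_preim T y r =
  lim_sup_set (fun n => iter n T @^-1` ball y (r n) `&` I01).
Proof.
apply/seteqP; split => x.
  by move=> [Ix yx] N _; have [n Nn yn] := yx N; exists n.
move=> yx; split; first by have [n _ []] := yx 0%N I.
by move=> N; have [n Nn [yn _]] := yx N I; exists n.
Qed.

Lemma measurable_limsup_preim : measurable (limsup_preim T y r).
Proof.
rewrite limsup_preimE; apply: measurable_limsup_preimage => // n.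
exact: measurable_ball.
Qed.

(** For [n >= p] one has [1 / n <= 2 / (n + p)], so the factor 2 absorbs the time shift. *)
Lemma approach_sub_limsup_preim :
  (\forall n \near \oo, 2 / n%:R <= r n) ->
  approach T y `<=` limsup_preim T y r.
Proof.
move=> [N0 _ rN0] x [p _ apx].
split; first by have [n _ []] := apx 0%N I.
move=> N; have [n /= Nn [yn _]] := apx (N + N0 + p.+1)%N I.
exists (n + p)%N; first by lia.
have rn : 2 / (n + p)%:R <= r (n + p)%N by apply: rN0; rewrite /=; lia.
apply: le_ball yn; apply: le_trans rn.
rewrite -[leLHS]mul1r ler_pdivrMr ?ltr0n; last by lia.
rewrite mulrAC ler_pdivlMr ?ltr0n; last by lia.
by rewrite mul1r -natrM ler_nat; lia.
Qed.

Lemma BC_property_of_full : mu (limsup_preim T y r) = 1%E -> BC_property T r y.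
Proof.
move=> full; split; last by split; [exact: measurable_limsup_preim|].
apply/eqP; rewrite -leye_eq leNgt; apply/negP => fin.
(* The ball is cut down to [I01] first, so that measure preservation applies; the limsup set is
   unchanged. *)
pose F n := iter n T @^-1` (ball y (r n) `&` I01) `&` I01.
have mB n : measurable (ball y (r n) `&` I01).
  by apply: measurableI; [exact: measurable_ball|exact: measurable_I01].
have mF n : measurable (F n) by apply: measurable_preimage_iter => //.
have : mu (lim_sup_set F) = 0%E.
  apply: lim_sup_set_cvg0 => //; apply: le_lt_trans fin.
  apply: lee_nneseries => [n _ _|n _]; first exact: measure_ge0.
  rewrite -[leLHS]/(mu (F n)) lebesgue_measure_preimage_iter//.
  apply: le_measure; rewrite ?inE; first exact: mB.
    apply: measurableI; [exact: measurable_ball|exact: measurable_I01c].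
  by move=> z [yz /andP[z0 z1]]; split=> //; apply/andP; rewrite z0 ltW.
have -> : lim_sup_set F = limsup_preim T y r.
  rewrite limsup_preimE; congr lim_sup_set; apply/funext => n.
  apply/seteqP; split => x /=; first by move=> [[]].
  by move=> [yx Ix]; split=> //; split=> //; exact: iter_I01.
by rewrite full => /eqP; rewrite onee_eq0.
Qed.

End shrinking_targets.

(** * Passage to almost every center by recurrence and local isometry *)

Theorem theorem3p7 (R : realType) (T : R -> R) :
  is_IET T -> property_Ptilde T ->
  exists K : R, 0 < K /\
    forall r : nat -> R,
      (forall n, 0 < r n) ->
      (forall n m, (n <= m)%N -> r m <= r n) ->
      (\forall n \near \oo, K / n%:R <= r n) ->
      \forall y \ae (@lebesgue_measure R),
        I01c y -> BC_property T r y.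
Proof.
move=> [k [a [t [a0 ak a_lt aT bijT]]]] [ergT _].
exists 2; split=> // r _ _ rK.
have TI := iet_I01 bijT.
have mT := measurable_iet_preimage a0 ak a_lt aT.
have muT := lebesgue_measure_iet_preimage a0 ak a_lt aT bijT.
have /choice[f fP] (m : nat) : exists bwh : R * R * nat,
    [/\ is_tower T bwh.1.1 bwh.1.2 bwh.2, k.+1%:R^-1 <= bwh.2%:R * bwh.1.2
      & bwh.1.2 <= m.+2%:R^-1].
  (* [m.+2] rather than [m.+1] keeps [v < 1] at [m = 0]. *)
  have v01 : 0 < (m.+2%:R^-1 : R) < 1.
    by rewrite invr_gt0 ltr0n /= invf_plt ?posrE ?ltr0n// invr1 ltr1n.
  have [b [w [h bwh]]] := exists_tower a0 ak a_lt aT bijT ergT v01.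
  by exists (b, w, h).
have c0 : (0 : R) < k.+1%:R^-1 by rewrite invr_gt0 ltr0n.
have [|||Y [mY YI Y0 Yfull]] := exists_approach_full TI mT ergT c0
  (b := fun m => (f m).1.1) (w := fun m => (f m).1.2) (h := fun m => (f m).2).
- by move=> m; case: (fP m).
- by move=> m; case: (fP m).
- move=> m; have [_ _ /le_trans] := fP m; apply.
  by rewrite lef_pV2 ?posrE ?ltr0n// ler_nat.
pose V := lim_sup_set (fun n => iter n T @^-1` Y `&` I01).
pose D : set R := (a @` `I_k) `&` I01.
have mV : measurable V by exact: measurable_limsup_preimage.
have mD : measurable D.
  apply: measurableI; last exact: measurable_I01.
  exact/countable_measurable/finite_set_countable/finite_image/finite_II.
have D0 : lebesgue_measure D = 0%E.
  apply: countable_lebesgue_measure0.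
  apply: sub_countable (subset_card_le (@subIsetl _ _ _)) _.
  exact/finite_set_countable/finite_image/finite_II.
(* Points whose orbit meets a break point; local isometry is only available off this null set. *)
pose hit := \bigcup_n (iter n T @^-1` D `&` I01).
have hit_null : (@lebesgue_measure R).-negligible hit.
  apply: negligible_bigcup => n; exists (iter n T @^-1` D `&` I01); split=> //.
    exact: measurable_preimage_iter.
  rewrite -D0; apply: lebesgue_measure_preimage_iter => //; exact: subIsetr.
have VI : V `<=` I01 by move=> x /(_ 0%N I)[n _ []].
have V_null : (@lebesgue_measure R).-negligible (I01c `\` V).
  have mI : measurable (@I01c R) := @measurable_I01c R.
  exists (I01c `\` V); split=> //; first exact: measurableD.
  have VIc : I01c `&` V = V.
    apply/setIidPr => x /VI /andP[x0 x1]; apply/andP; rewrite x0; split=> //.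
    exact: ltW.
  have muI : lebesgue_measure (@I01c R) = 1%E.
    by rewrite I01cE lebesgue_measure_itv/= lte01 oppr0 adde0.
  rewrite measureD//= ?muI ?ltry// VIc.
  by rewrite (visits_infinitely_often TI mT muT ergT mY YI Y0) -EFinB subrr.
(* The endpoint [1] falls in the second null set, as [V] lies in [[0, 1)]. *)
apply: negligibleS (negligibleU hit_null V_null) => y /= /not_implyP[Iy nBC].
apply: contrapT => /not_orP[nhit nV].
have Vy : V y by apply: contrapT => nVy; apply: nV.
have Iy' := VI _ Vy.
apply: nBC; apply: (BC_property_of_full TI mT muT).
have avoid n i : (i < k)%N -> iter n T y <> a i.
  move=> ik ya; apply: nhit; exists n => //; split=> //; split.
    by exists i.
  exact: iter_I01.
(* One visit of [y] to [Y] suffices: [approach T (iter n T y)] is full and, by local isometry,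
   contained in [approach T y]. *)
have [n _ [Yn _]] := Vy 0%N I.
apply/eqP; rewrite eq_le; apply/andP; split.
  apply: lebesgue_measure_le1; first exact: measurable_limsup_preim.
  by move=> x [].
rewrite -(Yfull _ Yn); apply: le_measure; rewrite ?inE.
- exact: measurable_approach.
- exact: measurable_limsup_preim.
- apply: subset_trans (approach_sub_limsup_preim rK).
  exact: approach_iter a0 ak aT bijT _ _ Iy' avoid.
Qed.
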